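(* Let $A\subseteq\Gamma$ be a finite set, $D=A-A$, $S=A+A$. Then $$\mathsf{E}_3^2(D,A,A),\ \mathsf{E}_3^2(S,A,A)\ \ge\ \frac{|A|^{13}}{|A-A|^2\,\mathsf{E}(A)},$$ and $$(\mathsf{E}^D_3(D))^4\ge\max\Big\{|D|^{12},\frac{|A|^{45}}{\mathsf{E}^9(A)|D|^2}\Big\},\qquad (\mathsf{E}^D_3(S))^4\ge\max\Big\{|S|^{12},\frac{|A|^{45}}{\mathsf{E}^9(A)|D|^2}\Big\}.$$ Further, let $\beta,\gamma\in[0,1]$ with $\beta\le1/2$. If $A$ is $(2,\beta,\gamma)$-connected then $\mathsf{E}_3^2(D,A,A),\ \mathsf{E}_3^2(S,A,A)\gg\gamma|A|^5\mathsf{E}(A)$. If $A$ is $(3/2,\beta,\gamma)$-connected then $$\mathsf{E}^D_3(D),\ \mathsf{E}^D_3(S)\gg\gamma\frac{|A|^{33/4}\mathsf{E}_{3/2}(A)}{\mathsf{E}^{9/4}(A)\log|A|},$$ and if $A$ is $(2,\beta,\gamma)$-connected then $$\mathsf{E}^D_3(D),\ \mathsf{E}^D_3(S)\gg\gamma\frac{|A|^{17/2}}{\mathsf{E}^{3/2}(A)\log|A|}.$$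
   Context: $\Gamma$ is an abelian group, all sets finite and identified with indicator functions. $(f\circ g)(x)=\sum_y f(y)g(y+x)$. For $X\subseteq\Gamma$, $X_s=X\cap(X-s)$, so $|X_s|=(X\circ X)(s)$. $\mathsf{E}(A)=\sum_x(A\circ A)(x)^2$, $\mathsf{E}_k(A)=\sum_x(A\circ A)(x)^k$ for real $k\ge1$. $\mathsf{E}_3(X,A,A)=\sum_x(X\circ X)(x)(A\circ A)(x)^2$. For $P\subseteq\Gamma$, $\mathsf{E}^P_k(X)=\sum_{s\in P}|X_s|^k$. For real $\alpha>1$, $A$ is $(\alpha,\beta,\gamma)$-connected if every $B\subseteq A$ with $|B|\ge\beta|A|$ satisfies $\mathsf{E}_\alpha(B)\ge\gamma(|B|/|A|)^{2\alpha}\mathsf{E}_\alpha(A)$. $\ll,\gg$ hide absolute constants; logarithms base 2. *)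

(* Defs.v *)
From HB Require Import structures.
From mathcomp Require Import all_boot all_order all_algebra.
From mathcomp Require Import finmap.
From mathcomp Require Import reals exp.
Set Implicit Arguments. Unset Strict Implicit. Unset Printing Implicit Defensive.
Import Order.TTheory GRing.Theory Num.Theory.
Local Open Scope ring_scope.
Local Open Scope fset_scope.

Section Defs.
Variable T : zmodType.

Definition sumset (A B : {fset T}) : {fset T} := [fset (a + b)%R | a : T in A, b : T in B].
Definition diffset (A B : {fset T}) : {fset T} := [fset (a - b)%R | a : T in A, b : T in B].

(* (X o X)(x) = |X_x| = |X cap (X - x)| = #{y in X | y + x in X} *)
Definition rep (X : {fset T}) (x : T) : nat := #|` [fset y in X | (y + x)%R \in X] |.

(* E(A) = sum_x (A o A)(x)^2 ; (A o A) is supported on A - A *)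
Definition energy (A : {fset T}) : nat := \sum_(x <- diffset A A) rep A x ^ 2.

(* E_3(X,A,A) = sum_x (X o X)(x) (A o A)(x)^2 ; supported on A - A *)
Definition energy3 (X A : {fset T}) : nat :=
  \sum_(x <- diffset A A) rep X x * rep A x ^ 2.

Definition energyP (k : nat) (P X : {fset T}) : nat := \sum_(s <- P) rep X s ^ k.

Variable R : realType.

Definition energyR (k : R) (A : {fset T}) : R :=
  \sum_(x <- diffset A A) (rep A x)%:R `^ k.

Definition connected (alpha beta gamma : R) (A : {fset T}) : Prop :=
  forall B : {fset T}, B `<=` A -> beta * (#|` A|)%:R <= (#|` B|)%:R ->
    gamma * (((#|` B|)%:R / (#|` A|)%:R) `^ (2 * alpha)) * energyR alpha A
      <= energyR alpha B.

End Defs.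

Definition log2 {R : realType} (x : R) : R := ln x / ln 2.

(* Main.v *)
Require Import Defs.
From mathcomp Require Import all_boot all_order all_algebra.
From mathcomp Require Import finmap.
From mathcomp Require Import reals exp.
From mathcomp Require Import ring lra.
Set Implicit Arguments.
Unset Strict Implicit.
Unset Printing Implicit Defensive.
Import Order.TTheory GRing.Theory Num.Theory.
Local Open Scope ring_scope.

(** Let [C] be [A] or [-A], so that [X = C + A] is [A + A] or [A - A], and put
    [d p = sum_(q in A) |A_(q-p)|], so that [d] sums to [E(A)] over [A].  The
    Katz-Koester inclusion [C + A_s <= X_s] and Cauchy-Schwarz for [C + A_s] give
    [|A|^2 sum_(A_s) 1/d <= |X_s|], hence [|A|^2 (f o f)(s) <= |X_s|] with
    [f = d^(-1/2)].  On the other hand, Cauchy-Schwarz over the sums [c + p], with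
    [c] in [C] and [p] in [A_s], bounds the square of
    [(sum h) (sum_s (f o g)(s) v(s))] by
    [(sum_s |X_s| v(s)^2) (sum (h o h)(f o f)(g o g))].  Estimating the last factor
    by the pointwise bound gives [E_3(X,A,A) >= |A|^2 sum d^(1/2)] and
    [E_3^D(X)^4 |D|^2 >= |A|^18 (sum d^(-1/2))^18], and Hoelder's inequality yields
    the unconditional bounds.  In the connected case one takes for [f] the indicator
    function of the half of [A] on which [d] is at most twice its mean, while for
    [E_3(X,A,A)] the half on which [d^(1/2)] is at most twice its mean has energy
    [O((sum d^(1/2))^2 / |A|)]. *)

Section SumInequalities.
Variables (R : realFieldType) (I : eqType) (r : seq I).

Lemma cauchy_schwarz_sum (a b t : I -> R) :
  {in r, forall i, 0 <= a i} -> {in r, forall i, 0 <= b i} ->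
  {in r, forall i, t i ^+ 2 <= a i * b i} ->
  (\sum_(i <- r) t i) ^+ 2 <= (\sum_(i <- r) a i) * \sum_(i <- r) b i.
Proof.
move=> a_ge0 b_ge0 t_le.
suff [] : [/\ 0 <= \sum_(i <- r) a i, 0 <= \sum_(i <- r) b i
  & (\sum_(i <- r) t i) ^+ 2 <= (\sum_(i <- r) a i) * \sum_(i <- r) b i] by [].
rewrite !big_seq.
apply: (big_ind3 (fun x y z : R => [/\ 0 <= x, 0 <= y & z ^+ 2 <= x * y])).
- by rewrite mulr0 expr0n.
- move=> x y z x' y' z' [x0 y0 zxy] [x'0 y'0 z'xy']; split; rewrite ?addr_ge0 //.
  have cross : 2 * (z * z') <= x * y' + x' * y.
    have xy_ge0 : 0 <= x * y' + x' * y by rewrite addr_ge0 ?mulr_ge0.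
    apply: le_trans (ler_norm _) _; rewrite -ler_sqr ?nnegrE // real_normK ?num_real //.
    have : (z * z') ^+ 2 <= (x * y) * (x' * y').
      by rewrite exprMn ler_pM ?sqr_ge0.
    by have := sqr_ge0 (x * y' - x' * y); lra.
  by nra.
- by move=> i ir; split; [exact: a_ge0 | exact: b_ge0 | exact: t_le].
Qed.

Lemma hoelder_cube_sum (a b : I -> R) :
  {in r, forall i, 0 <= a i} -> {in r, forall i, 0 <= b i} ->
  (\sum_(i <- r) a i * b i ^+ 2) ^+ 3
    <= (\sum_(i <- r) a i ^+ 3) * (\sum_(i <- r) b i ^+ 3) ^+ 2.
Proof.
move=> a_ge0 b_ge0.
set S := \sum_(i <- r) _ * _; set P := \sum_(i <- r) a i ^+ 3.
set Q := \sum_(i <- r) b i ^+ 3; pose M := \sum_(i <- r) a i ^+ 2 * b i.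
have S_le : S ^+ 2 <= M * Q.
  apply: cauchy_schwarz_sum => i ir; rewrite ?mulr_ge0 ?exprn_ge0 ?a_ge0 ?b_ge0 //.
  by rewrite le_eqVlt; apply/predU1l; ring.
have M_le : M ^+ 2 <= P * S.
  apply: cauchy_schwarz_sum => i ir; rewrite ?mulr_ge0 ?exprn_ge0 ?a_ge0 ?b_ge0 //.
  by rewrite le_eqVlt; apply/predU1l; ring.
have P_ge0 : 0 <= P by rewrite /P big_seq sumr_ge0 // => i ir; rewrite exprn_ge0 ?a_ge0.
have [S0|S_neq0] := eqVneq S 0; first by rewrite S0 expr0n mulr_ge0 ?sqr_ge0.
have S_gt0 : 0 < S.
  rewrite lt_neqAle eq_sym S_neq0 /S big_seq sumr_ge0 // => i ir.
  by rewrite mulr_ge0 ?sqr_ge0 ?a_ge0.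
rewrite -(ler_pM2l S_gt0) -exprS (_ : S ^+ 4 = (S ^+ 2) ^+ 2); last by rewrite -exprM.
apply: (@le_trans _ _ ((M * Q) ^+ 2)).
  by rewrite ler_sqr ?nnegrE ?sqr_ge0 // (le_trans _ S_le) ?sqr_ge0.
by rewrite exprMn [leRHS]mulrA [S * P]mulrC ler_wpM2r ?sqr_ge0.
Qed.

Lemma size_sqr_le_sum_mul_suminv (x : I -> R) : {in r, forall i, 0 < x i} ->
  (size r)%:R ^+ 2 <= (\sum_(i <- r) x i) * \sum_(i <- r) (x i)^-1.
Proof.
move=> x_gt0; rewrite -sum1_size natr_sum.
apply: cauchy_schwarz_sum => i /x_gt0 xi; rewrite ?invr_ge0 ?(ltW xi) //.
by rewrite expr1n divff // gt_eqF.
Qed.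

Lemma sqr_sum_le_size_mul_sum_sqr (x : I -> R) :
  (\sum_(i <- r) x i) ^+ 2 <= (size r)%:R * \sum_(i <- r) x i ^+ 2.
Proof.
rewrite -sum1_size natr_sum.
by apply: cauchy_schwarz_sum => i _; rewrite ?sqr_ge0 // mul1r.
Qed.

Lemma size_cube_le_sqr_sum_mul_sum_inv_sqr (x : I -> R) : {in r, forall i, 0 < x i} ->
  (size r)%:R ^+ 3 <= (\sum_(i <- r) x i) ^+ 2 * \sum_(i <- r) (x i)^-1 ^+ 2.
Proof.
move=> x_gt0; set n : R := (size r)%:R; set X := \sum_(i <- r) x i.
have [->|n_neq0] := eqVneq n 0.
  by rewrite expr0n mulr_ge0 ?sqr_ge0 ?sumr_ge0 // => i _; apply: sqr_ge0.
have n_gt0 : 0 < n by rewrite lt_neqAle eq_sym n_neq0 ler0n.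
rewrite -(ler_pM2l n_gt0) -exprS (_ : n ^+ 4 = (n ^+ 2) ^+ 2); last by rewrite -exprM.
apply: (@le_trans _ _ ((X * \sum_(i <- r) (x i)^-1) ^+ 2)).
  have := size_sqr_le_sum_mul_suminv x_gt0 => n_le.
  by rewrite ler_sqr ?nnegrE ?sqr_ge0 // (le_trans _ n_le) ?sqr_ge0.
by rewrite exprMn [leRHS]mulrCA ler_wpM2l ?sqr_ge0 ?sqr_sum_le_size_mul_sum_sqr.
Qed.

Lemma symmetric_form_le (K : I -> I -> R) (w : I -> R) :
  (forall p q, 0 <= K p q) -> (forall p q, K p q = K q p) ->
  \sum_(p <- r) \sum_(q <- r) K p q * (w p * w q)
    <= \sum_(p <- r) w p ^+ 2 * \sum_(q <- r) K p q.
Proof.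
move=> K_ge0 KC; set L := \sum_(p <- r) _; set U := \sum_(p <- r) _.
have UE : U = \sum_(p <- r) \sum_(q <- r) K p q * w p ^+ 2.
  by apply: eq_bigr => p _; rewrite mulr_sumr; apply: eq_bigr => q _; rewrite mulrC.
have UE' : U = \sum_(p <- r) \sum_(q <- r) K p q * w q ^+ 2.
  by rewrite exchange_big UE; apply: eq_bigr => p _; apply: eq_bigr => q _; rewrite KC.
suff : 2 * L <= U + U by lra.
rewrite {1}UE UE' mulr_sumr -big_split; apply: ler_sum => p _ /=.
rewrite mulr_sumr -big_split; apply: ler_sum => q _ /=.
rewrite mulrCA -mulrDr ler_wpM2l //.
by have := sqr_ge0 (w p - w q); lra.
Qed.

End SumInequalities.

Lemma natr_card_fset (R : pzSemiRingType) (I : choiceType) (A : {fset I}) :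
  (#|` A|)%:R = \sum_(p <- A) 1 :> R.
Proof. by rewrite -sum1_size natr_sum. Qed.

Lemma ler_sum_fsubset (R : numDomainType) (I : choiceType) (A B : {fset I})
    (F : I -> R) :
  (B `<=` A)%fset -> {in A, forall p, 0 <= F p} ->
  \sum_(p <- B) F p <= \sum_(p <- A) F p.
Proof.
move=> BA F_ge0; rewrite [leRHS](big_fsetID _ (mem B)) /=.
have -> : [fset x in A | x \in B]%fset = B.
  by apply/fsetP => p; rewrite !inE /= andb_idl //; apply: (fsubsetP BA).
rewrite lerDl big_seq; apply: sumr_ge0 => p.
by rewrite !inE => /andP[/F_ge0].
Qed.

Section RegularPart.
Variables (R : realFieldType) (I : choiceType) (A : {fset I}) (g : I -> R).

Definition regular_part : {fset I} :=
  [fset p in A | (g p <= 2 * (\sum_(q <- A) g q) / (#|` A|)%:R)%R]%fset.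

Lemma regular_part_sub : (regular_part `<=` A)%fset.
Proof. by apply/fsubsetP => p; rewrite !inE => /andP[]. Qed.

Lemma regular_part_le p : p \in regular_part ->
  g p <= 2 * (\sum_(q <- A) g q) / (#|` A|)%:R.
Proof. by rewrite !inE => /andP[]. Qed.

Lemma card_regular_part : {in A, forall p, 0 <= g p} -> 0 < \sum_(p <- A) g p ->
  (#|` A|)%:R <= 2 * (#|` regular_part|)%:R :> R.
Proof.
set S := \sum_(p <- A) _ => g_ge0 S_gt0.
set B := regular_part; set n : R := (#|` A|)%:R.
have n_gt0 : 0 < n.
  rewrite ltr0n cardfs_gt0; apply: contraTneq S_gt0 => A0.
  by rewrite /S A0 big_seq_fset0 ltxx.
pose t := 2 * S / n.
have markov : (n - (#|` B|)%:R) * t <= S.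
  have -> : n = (#|` B|)%:R + \sum_(p <- A | ~~ (g p <= t)) 1.
    rewrite /n !natr_card_fset (big_fsetID _ (fun p => g p <= t)) /=.
    by rewrite -[in X in _ + X]big_fset_condE.
  rewrite addrC addKr mulr_suml /S [leRHS](bigID (fun p => g p <= t)) /=.
  rewrite addrC ler_wpDr //.
    by rewrite big_seq_cond sumr_ge0 // => p /andP[/g_ge0].
  by apply: ler_sum => p; rewrite -ltNge mul1r => /ltW.
move: markov; rewrite /t mulrA ler_pdivrMr // mulrA [S * n]mulrC ler_pM2r //.
by lra.
Qed.

End RegularPart.

Section Slices.
Variable T : zmodType.
Implicit Types (A B C X : {fset T}) (s : T).

(* [slice A s] is the set [A_s] of the paper. *)
Definition slice A s : {fset T} := [fset y in A | (y + s)%R \in A]%fset.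

Lemma rep_slice A s : rep A s = #|` slice A s|.
Proof. by []. Qed.

Lemma slice_sub A s : (slice A s `<=` A)%fset.
Proof. by apply/fsubsetP => y; rewrite !inE => /andP[]. Qed.

Lemma sliceS A B s : (A `<=` B)%fset -> (slice A s `<=` slice B s)%fset.
Proof.
move=> /fsubsetP AB; apply/fsubsetP => y; rewrite !inE /= => /andP[yA ysA].
by rewrite !AB.
Qed.

Lemma slice0 A : slice A 0 = A.
Proof. by apply/fsetP => y; rewrite !inE addr0 andbb. Qed.

Lemma sliceC A s x : slice (slice A s) x = slice (slice A x) s.
Proof. by apply/fsetP => y; rewrite !inE /= andbACA [y + x + s]addrAC. Qed.

Lemma repS A B s : (A `<=` B)%fset -> (rep A s <= rep B s)%N.
Proof. by move=> AB; rewrite !rep_slice fsubset_leq_card ?sliceS. Qed.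

Lemma mem_sumset A B x y : x \in A -> y \in B -> x + y \in sumset A B.
Proof. by move=> xA yB; apply: (in_imfset2 _ (fun a b : T => a + b)). Qed.

Lemma mem_diffset A B x y : x \in A -> y \in B -> x - y \in diffset A B.
Proof. by move=> xA yB; apply: (in_imfset2 _ (fun a b : T => a - b)). Qed.

Lemma sumset_sub A B X :
  {in A & B, forall x y, x + y \in X} -> (sumset A B `<=` X)%fset.
Proof. by move=> ABX; apply/fsubsetP => _ /imfset2P[x xA [y yB ->]]; apply: ABX. Qed.

Lemma diffsetS A B : (B `<=` A)%fset -> (diffset B B `<=` diffset A A)%fset.
Proof.
move=> /fsubsetP BA; apply/fsubsetP => _ /imfset2P[x xB [y yB ->]].
by rewrite mem_diffset ?BA.
Qed.

Lemma diffset0 A : A != fset0 -> 0 \in diffset A A.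
Proof. by move=> /fset0Pn[a aA]; rewrite -(subrr a) mem_diffset. Qed.

Lemma rep_gt0 A s : (0 < rep A s)%N = (s \in diffset A A).
Proof.
rewrite rep_slice cardfs_gt0; apply/fset0Pn/imfset2P => [[y]|[x xA [y yA ->]]].
  rewrite !inE /= => /andP[yA ysA].
  by exists (y + s) => //; exists y; rewrite // addrC addKr.
by exists y; rewrite !inE /= yA addrC subrK.
Qed.

Definition deg C A p : nat := \sum_(q <- A) rep C (q - p).

Lemma deg_gt0 C A p : C != fset0 -> p \in A -> (0 < deg C A p)%N.
Proof.
move=> C_neq0 pA; rewrite /deg (big_fsetD1 p) //= ltn_addr // rep_gt0 subrr.
exact: diffset0.
Qed.

Lemma energy_gt0 A : A != fset0 -> (0 < energy A)%N.
Proof.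
move=> A_neq0; rewrite /energy (big_fsetD1 0) ?diffset0 //= ltn_addr //.
by rewrite expn_gt0 rep_gt0 diffset0.
Qed.

Lemma katz_koester C A X s :
  (sumset C A `<=` X)%fset -> (sumset C (slice A s) `<=` slice X s)%fset.
Proof.
move=> /fsubsetP CAX; apply: sumset_sub => c p cC; rewrite !inE /= => /andP[pA psA].
by rewrite -addrA !CAX ?mem_sumset.
Qed.

End Slices.

Section Correlation.
Variables (R : comNzRingType) (T : zmodType).
Implicit Types (A B C P : {fset T}) (f g h F G : T -> R) (s x y : T).

Lemma sum_slice A s F : \sum_(p <- slice A s) F p = \sum_(p <- A | p + s \in A) F p.
Proof. by rewrite -big_fset_condE. Qed.

Lemma sum_translate P A p F : {in A, forall q, q - p \in P} ->
  \sum_(s <- P | p + s \in A) F (p + s) = \sum_(q <- A) F q.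
Proof.
move=> AP; rewrite big_fset_condE.
have -> : [fset s in P | (p + s)%R \in A]%fset = [fset (q - p)%R | q in A]%fset.
  apply/fsetP => s; rewrite !inE; apply/andP/imfsetP => [[_ psA]|[q qA ->]].
    by exists (p + s); rewrite // addrC addKr.
  by rewrite [p + _]addrC subrK; split; first exact: AP.
rewrite big_imfset /=; first by apply: eq_bigr => q _; rewrite [p + _]addrC subrK.
by move=> q q' _ _ /addIr.
Qed.

Definition cor A f g s : R := \sum_(p <- slice A s) f p * g (p + s).

Lemma rep_cor A s : (rep A s)%:R = cor A (fun=> 1) (fun=> 1) s.
Proof. by rewrite rep_slice natr_card_fset; apply: eq_bigr => p _; rewrite mulr1. Qed.

Lemma sum_cor A P f g G : (diffset A A `<=` P)%fset ->
  \sum_(s <- P) cor A f g s * G s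
    = \sum_(p <- A) \sum_(q <- A) f p * g q * G (q - p).
Proof.
move=> /fsubsetP AAP; under eq_bigr do rewrite mulr_suml sum_slice.
rewrite (exchange_big_dep predT) //=; apply: eq_big_seq => p pA.
rewrite -(sum_translate (P := P) (p := p)) => [|q qA]; last by rewrite AAP ?mem_diffset.
by apply: eq_bigr => s _; rewrite [p + s]addrC addrK.
Qed.

Lemma corN A f g s : cor A f g (- s) = cor A g f s.
Proof.
have sliceP q : q \in slice A (- s) -> q - s \in A by rewrite !inE => /andP[].
rewrite /cor -(sum_translate (p := s) (P := A)) => [|q /sliceP //].
rewrite sum_slice big_seq_cond [RHS]big_seq_cond; apply: eq_big => [p|p _].
  by rewrite !inE /= [s + p]addrC addrK; case: (p \in A); rewrite // andbT.
by rewrite [s + p]addrC addrK mulrC.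
Qed.

Lemma cor_slice A f g s x :
  cor (slice A s) (fun p => f p * g (p + s)) (fun p => f p * g (p + s)) x
    = cor (slice A x) (fun p => f p * f (p + x)) (fun p => g p * g (p + x)) s.
Proof.
by rewrite /cor sliceC; apply: eq_bigr => p _; rewrite [p + x + s]addrAC; ring.
Qed.

Lemma sum_cor_slice A f g x :
  \sum_(s <- diffset A A)
      cor (slice A s) (fun p => f p * g (p + s)) (fun p => f p * g (p + s)) x
    = cor A f f x * cor A g g x.
Proof.
under eq_bigr do rewrite cor_slice -[cor _ _ _ _]mulr1.
rewrite (sum_cor (fun p => f p * f (p + x)) (fun p => g p * g (p + x)) (fun=> 1)
  (diffsetS (slice_sub A x))) big_distrlr.
by apply: eq_bigr => p _; apply: eq_bigr => q _; rewrite mulr1.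
Qed.

Definition conv C B h g y : R := \sum_(p <- B | y - p \in C) h (y - p) * g p.

Lemma sum_conv C B h g F :
  \sum_(y <- sumset C B) conv C B h g y * F y
    = \sum_(p <- B) \sum_(c <- C) h c * g p * F (c + p).
Proof.
under eq_bigr do rewrite mulr_suml.
rewrite (exchange_big_dep predT) //=; apply: eq_big_seq => p pB.
rewrite -(sum_translate (P := sumset C B) (p := - p)) => [|c cC].
  apply: eq_big => y; first by rewrite [- p + y]addrC.
  by move=> _; rewrite [- p + y]addrC subrK.
by rewrite opprK mem_sumset.
Qed.

Lemma sum_conv_sqr C B P h g : (diffset B B `<=` P)%fset ->
  \sum_(y <- sumset C B) conv C B h g y ^+ 2
    = \sum_(x <- P) cor B g g x * cor C h h x.
Proof.
move=> BBP; under eq_bigr do rewrite expr2.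
rewrite sum_conv sum_cor // [RHS]exchange_big; apply: eq_bigr => p _ /=.
under eq_bigr do rewrite mulr_sumr.
rewrite (exchange_big_dep predT) //=; apply: eq_bigr => q _.
rewrite /cor sum_slice mulr_sumr; apply: eq_big => c; rewrite addrA //.
by move=> _; ring.
Qed.

End Correlation.

Section CorrelationInequalities.
Variables (R : realFieldType) (T : zmodType).
Implicit Types (A B C P X : {fset T}) (f g h v : T -> R) (s : T).

Lemma cor_ge0 A f g s : {in A, forall p, 0 <= f p} -> {in A, forall p, 0 <= g p} ->
  0 <= cor A f g s.
Proof.
move=> f_ge0 g_ge0; rewrite /cor big_seq; apply: sumr_ge0 => p.
by rewrite !inE => /andP[pA psA]; rewrite mulr_ge0 ?f_ge0 ?g_ge0.
Qed.

Lemma cor_le_half_sum_sqr A f s :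
  2 * cor A f f s
    <= \sum_(p <- slice A s) f p ^+ 2 + \sum_(p <- slice A (- s)) f p ^+ 2.
Proof.
have -> : \sum_(p <- slice A (- s)) f p ^+ 2 = \sum_(p <- slice A s) f (p + s) ^+ 2.
  transitivity (cor A (fun p => f p ^+ 2) (fun=> 1) (- s)).
    by apply: eq_bigr => p _; rewrite mulr1.
  by rewrite corN; apply: eq_bigr => p _; rewrite mul1r.
rewrite mulr_sumr -big_split; apply: ler_sum => p _ /=.
by have := sqr_ge0 (f p - f (p + s)); lra.
Qed.

Lemma sqr_sum_le_sumset C B X P h g :
  (sumset C B `<=` X)%fset -> (diffset B B `<=` P)%fset ->
  ((\sum_(c <- C) h c) * \sum_(p <- B) g p) ^+ 2
    <= (#|` X|)%:R * \sum_(x <- P) cor B g g x * cor C h h x.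
Proof.
move=> CBX BBP; rewrite -sum_conv_sqr //.
have -> : (\sum_(c <- C) h c) * \sum_(p <- B) g p
    = \sum_(y <- sumset C B) conv C B h g y.
  under [RHS]eq_bigr do rewrite -[conv _ _ _ _ _]mulr1.
  rewrite (sum_conv _ _ _ _ (fun=> 1)) big_distrlr exchange_big.
  by apply: eq_bigr => p _; apply: eq_bigr => c _; rewrite mulr1.
apply: le_trans (sqr_sum_le_size_mul_sum_sqr _ _) _.
by rewrite ler_wpM2r ?ler_nat ?fsubset_leq_card ?sumr_ge0 // => y _; rewrite sqr_ge0.
Qed.

Lemma cauchy_schwarz_cor C A X h f g v : (sumset C A `<=` X)%fset ->
  ((\sum_(c <- C) h c) * \sum_(s <- diffset A A) cor A f g s * v s) ^+ 2
    <= (\sum_(s <- diffset A A) (rep X s)%:R * v s ^+ 2)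
       * \sum_(x <- diffset A A) cor C h h x * cor A f f x * cor A g g x.
Proof.
move=> CAX; set D := diffset A A.
pose fg s p := f p * g (p + s).
pose Q s := \sum_(x <- D) cor (slice A s) (fg s) (fg s) x * cor C h h x.
have sliceD s : (diffset (slice A s) (slice A s) `<=` D)%fset.
  exact: diffsetS (slice_sub A s).
have -> : \sum_(x <- D) cor C h h x * cor A f f x * cor A g g x = \sum_(s <- D) Q s.
  rewrite exchange_big; apply: eq_bigr => x _.
  by rewrite -mulrA -sum_cor_slice mulrC mulr_suml.
rewrite mulr_sumr; apply: cauchy_schwarz_sum => s _.
- by rewrite mulr_ge0 ?sqr_ge0.
- by rewrite /Q -sum_conv_sqr // sumr_ge0 // => y _; apply: sqr_ge0.
rewrite mulrA exprMn [leRHS]mulrAC ler_wpM2r ?sqr_ge0 //.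
exact: sqr_sum_le_sumset (katz_koester s CAX) (sliceD s).
Qed.

End CorrelationInequalities.

Section DegreeAndEnergy.
Variables (R : realFieldType) (T : zmodType).
Implicit Types (A B C X : {fset T}) (f : T -> R) (p s : T).

Lemma natr_energyP k (P X : {fset T}) :
  (energyP k P X)%:R = \sum_(s <- P) (rep X s)%:R ^+ k :> R.
Proof. by rewrite natr_sum; apply: eq_bigr => s _; rewrite natrX. Qed.

Lemma natr_energyPS k (P Q X : {fset T}) : (P `<=` Q)%fset ->
  (energyP k P X)%:R <= (energyP k Q X)%:R :> R.
Proof.
move=> PQ; rewrite !natr_energyP.
by apply: ler_sum_fsubset => // s _; apply: exprn_ge0.
Qed.

Lemma natr_deg C A p : (deg C A p)%:R = \sum_(q <- A) (rep C (q - p))%:R :> R.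
Proof. exact: natr_sum. Qed.

Lemma natr_degS C C' A A' p : (C `<=` C')%fset -> (A `<=` A')%fset ->
  (deg C A p)%:R <= (deg C' A' p)%:R :> R.
Proof.
move=> CC' AA'; rewrite !natr_deg; apply: le_trans (ler_sum_fsubset AA' _) => //.
by apply: ler_sum => q _; rewrite ler_nat repS.
Qed.

Lemma sum_deg C A :
  \sum_(p <- A) (deg C A p)%:R
    = \sum_(x <- diffset A A) (rep A x)%:R * (rep C x)%:R :> R.
Proof.
under [RHS]eq_bigr do rewrite rep_cor.
rewrite sum_cor //; apply: eq_bigr => p _; rewrite natr_deg.
by apply: eq_bigr => q _; rewrite !mul1r.
Qed.

Lemma sum_deg_energy A : \sum_(p <- A) (deg A A p)%:R = (energy A)%:R :> R.
Proof. by rewrite sum_deg natr_sum; apply: eq_bigr => x _; rewrite natrX expr2. Qed.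

Lemma energy_le_sum_deg A B : (B `<=` A)%fset ->
  (energy B)%:R <= \sum_(p <- B) (deg A A p)%:R :> R.
Proof.
by move=> BA; rewrite -sum_deg_energy; apply: ler_sum => p _; apply: natr_degS.
Qed.

Lemma card_sumset_ge_sum_invdeg C A X : (sumset C A `<=` X)%fset ->
  (#|` C|)%:R ^+ 2 * \sum_(p <- A) (deg C A p)%:R^-1 <= (#|` X|)%:R :> R.
Proof.
move=> CAX; pose w p : R := (deg C A p)%:R^-1; rewrite -/(\sum_(p <- A) w p).
set r := \sum_(p <- A) w p.
have form_le : \sum_(x <- diffset A A) cor A w w x * cor C (fun=> 1) (fun=> 1) x <= r.
  rewrite sum_cor //.
  rewrite (_ : \sum_(p <- A) _
      = \sum_(p <- A) \sum_(q <- A) (rep C (q - p))%:R * (w p * w q)); last first.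
    by apply: eq_bigr => p _; apply: eq_bigr => q _; rewrite -rep_cor mulrC.
  have repC p q : (rep C (q - p))%:R = (rep C (p - q))%:R :> R.
    by rewrite !rep_cor -(corN _ _ _ (p - q)) opprB.
  pose K p q : R := (rep C (q - p))%:R.
  apply: le_trans (symmetric_form_le (K := K) _ _ _ repC) _ => //.
  apply: ler_sum => p _; rewrite -natr_deg /w.
  have [->|d_neq0] := eqVneq (deg C A p) 0%N.
    by rewrite mulr0 invr0.
  by rewrite expr2 -mulrA mulVf ?mulr1 // pnatr_eq0.
have := sqr_sum_le_sumset (fun=> 1) w CAX (fsubset_refl _).
rewrite -natr_card_fset -/r => wC_le.
have [->|r_neq0] := eqVneq r 0; first by rewrite mulr0.
have r_gt0 : 0 < r.
  by rewrite lt_neqAle eq_sym r_neq0 sumr_ge0 // => p _; rewrite invr_ge0.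
rewrite -(ler_pM2r r_gt0) -mulrA -expr2 -exprMn; apply: le_trans wC_le _.
by rewrite ler_wpM2l.
Qed.

Lemma rep_ge_sum_invdeg C A X s : (sumset C A `<=` X)%fset ->
  (#|` C|)%:R ^+ 2 * \sum_(p <- slice A s) (deg C A p)%:R^-1 <= (rep X s)%:R :> R.
Proof.
move=> CAX; have [->|C_neq0] := eqVneq C fset0; first by rewrite cardfs0 expr0n mul0r.
rewrite rep_slice; apply: le_trans (card_sumset_ge_sum_invdeg (katz_koester s CAX)).
rewrite ler_wpM2l ?sqr_ge0 // big_seq [leRHS]big_seq; apply: ler_sum => p ps.
have pA := fsubsetP (slice_sub A s) p ps.
by rewrite lef_pV2 ?posrE ?ltr0n ?deg_gt0 ?natr_degS ?fsubset_refl ?slice_sub.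
Qed.

(* AM-GM turns the mean of the bounds at [s] and [-s] into a correlation. *)
Lemma rep_ge_cor C A B X f (M : R) s : (sumset C A `<=` X)%fset -> (B `<=` A)%fset ->
  C != fset0 -> 0 <= M -> {in B, forall p, f p ^+ 2 * (deg C A p)%:R <= M} ->
  (#|` C|)%:R ^+ 2 * cor B f f s <= M * (rep X s)%:R.
Proof.
move=> CAX BA C_neq0 M_ge0 f_le.
have slice_le t : (#|` C|)%:R ^+ 2 * \sum_(p <- slice B t) f p ^+ 2 <= M * (rep X t)%:R.
  apply: le_trans (ler_wpM2l M_ge0 (rep_ge_sum_invdeg t CAX)).
  rewrite mulrCA ler_wpM2l ?sqr_ge0 // mulr_sumr.
  apply: (@le_trans _ _ (\sum_(p <- slice B t) M * (deg C A p)%:R^-1)).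
    rewrite big_seq [leRHS]big_seq; apply: ler_sum => p /(fsubsetP (slice_sub B t)) pB.
    by rewrite ler_pdivlMr ?f_le // ltr0n deg_gt0 // (fsubsetP BA).
  by apply: ler_sum_fsubset (sliceS t BA) _ => p _; rewrite mulr_ge0 ?invr_ge0.
have rep_opp : (rep X (- s))%:R = (rep X s)%:R :> R by rewrite !rep_cor corN.
have := ler_wpM2l (sqr_ge0 (#|` C|)%:R) (cor_le_half_sum_sqr B f s).
have := slice_le s; have := slice_le (- s); rewrite rep_opp.
by rewrite mulrDr mulrCA; lra.
Qed.

End DegreeAndEnergy.

Section SignedSumset.
Variable T : zmodType.
Implicit Types (A B : {fset T}) (e : bool) (s x : T).

Definition signed e x : T := if e then - x else x.

Definition signed_set e A : {fset T} := [fset signed e a | a in A]%fset.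

Definition signed_sumset e A : {fset T} := sumset (signed_set e A) A.

Lemma signedK e : involutive (signed e).
Proof. by case: e => x; rewrite /= ?opprK. Qed.

Lemma signed_sumset_true A : signed_sumset true A = diffset A A.
Proof.
apply/fsetP => x; apply/imfset2P/imfset2P.
  move=> [_ /imfsetP[a aA ->] [b bA ->]].
  by exists b => //; exists a; rewrite // addrC.
move=> [b bA [a aA ->]].
by exists (- a); [apply: (in_imfset _ (signed true)) | exists b; rewrite // addrC].
Qed.

Lemma signed_sumset_false A : signed_sumset false A = sumset A A.
Proof. by rewrite /signed_sumset [signed_set _ _]imfset_id. Qed.

Lemma signed_sumsetS e A B :
  (B `<=` A)%fset -> (signed_sumset e B `<=` signed_sumset e A)%fset.
Proof.
move=> /fsubsetP BA; apply: sumset_sub => _ b /imfsetP[a aB ->] bB.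
by rewrite mem_sumset ?BA // (in_imfset _ (signed e)) ?BA.
Qed.

Lemma card_signed_set e A : #|` signed_set e A| = #|` A|.
Proof. by rewrite card_imfset //=; apply: (inv_inj (signedK e)). Qed.

Lemma sum_signed_set (R : nmodType) e A (F : T -> R) :
  \sum_(c <- signed_set e A) F c = \sum_(a <- A) F (signed e a).
Proof. by rewrite big_imfset //= => a b _ _; apply: (inv_inj (signedK e)). Qed.

Lemma cor_signed_set (R : comNzRingType) e A (f : T -> R) s :
  cor (signed_set e A) (f \o signed e) (f \o signed e) s = cor A f f s.
Proof.
case: e; last by rewrite [signed_set _ _]imfset_id.
rewrite -corN /cor !sum_slice.
rewrite big_mkcond sum_signed_set -big_mkcond /=; apply: eq_big => p; last first.
  by rewrite opprD !opprK.
by rewrite -opprD mem_imfset //; apply: oppr_inj.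
Qed.

Lemma rep_signed_set e A s : rep (signed_set e A) s = rep A s.
Proof.
apply/eqP; rewrite -(eqr_nat int) !rep_cor; apply/eqP.
exact: (cor_signed_set e A (fun=> 1)).
Qed.

Lemma deg_signed_set e A p : deg (signed_set e A) A p = deg A A p.
Proof. by apply: eq_bigr => q _; rewrite rep_signed_set. Qed.

End SignedSumset.

Section SignedInequalities.
Variables (R : realFieldType) (T : zmodType) (e : bool).
Implicit Types (A B X : {fset T}) (f g h v : T -> R) (s : T).

Lemma cauchy_schwarz_signed A X h f g v : (signed_sumset e A `<=` X)%fset ->
  ((\sum_(p <- A) h p) * \sum_(s <- diffset A A) cor A f g s * v s) ^+ 2
    <= (\sum_(s <- diffset A A) (rep X s)%:R * v s ^+ 2)
       * \sum_(x <- diffset A A) cor A h h x * cor A f f x * cor A g g x.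
Proof.
move=> /cauchy_schwarz_cor - /(_ _ (h \o signed e) f g v).
rewrite sum_signed_set; under eq_bigr do rewrite /= signedK.
by under [X in _ <= _ * X -> _]eq_bigr do rewrite cor_signed_set.
Qed.

Lemma rep_signed_sumset_ge_cor A B f (M : R) s :
  A != fset0 -> (B `<=` A)%fset -> 0 <= M ->
  {in B, forall p, f p ^+ 2 * (deg A A p)%:R <= M} ->
  (#|` A|)%:R ^+ 2 * cor B f f s <= M * (rep (signed_sumset e A) s)%:R.
Proof.
move=> A_neq0 BA M_ge0 f_le; rewrite -(card_signed_set e).
apply: rep_ge_cor (fsubset_refl _) BA _ M_ge0 _ => [|p pB].
  by rewrite -cardfs_gt0 card_signed_set cardfs_gt0.
by rewrite deg_signed_set f_le.
Qed.

Lemma card_diffset_ge_sum_invdeg A :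
  (#|` A|)%:R ^+ 2 * \sum_(p <- A) (deg A A p)%:R^-1 <= (#|` diffset A A|)%:R :> R.
Proof.
rewrite -signed_sumset_true -(card_signed_set true).
under eq_bigr do rewrite -(deg_signed_set true).
exact: card_sumset_ge_sum_invdeg.
Qed.

Lemma energyP_ge_weighted_cor B X (K : R) f v :
  (signed_sumset e B `<=` X)%fset -> 0 <= K ->
  {in B, forall p, 0 <= f p} -> (forall s, 0 <= v s) ->
  (forall s, K * cor B f f s <= (rep X s)%:R) ->
  K ^+ 9 * ((\sum_(p <- B) f p) * \sum_(s <- diffset B B) cor B f f s * v s) ^+ 6
    <= (energyP 3 (diffset B B) X)%:R ^+ 4 * (\sum_(s <- diffset B B) v s ^+ 3) ^+ 2.
Proof.
move=> BX K_ge0 f_ge0 v_ge0 cor_le; have := cauchy_schwarz_signed f f f v BX.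
set L := _ * _; set N := \sum_(s <- _) _ * _ ^+ 2; set Q := \sum_(x <- _) _ * _ * _.
set G := (energyP _ _ _)%:R; set V := \sum_(s <- _) v _ ^+ 3 => L_le.
have N_ge0 : 0 <= N by apply: sumr_ge0 => s _; rewrite mulr_ge0 ?sqr_ge0.
have G_ge0 : 0 <= G by apply: ler0n.
have N_le : N ^+ 3 <= G * V ^+ 2 by rewrite /G natr_energyP; apply: hoelder_cube_sum.
have Q_le : K ^+ 3 * Q <= G.
  rewrite /G natr_energyP mulr_sumr; apply: ler_sum => s _.
  by rewrite -!expr2 -exprSr -exprMn lerXn2r ?nnegrE ?mulr_ge0 ?cor_ge0.
have KL_le : K ^+ 3 * L ^+ 2 <= N * G.
  apply: le_trans (ler_wpM2l (exprn_ge0 3 K_ge0) L_le) _.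
  by rewrite mulrCA ler_wpM2l.
rewrite (_ : K ^+ 9 * L ^+ 6 = (K ^+ 3 * L ^+ 2) ^+ 3); last by ring.
apply: (@le_trans _ _ ((N * G) ^+ 3)).
  by rewrite lerXn2r ?nnegrE //; apply: mulr_ge0; rewrite ?sqr_ge0 ?exprn_ge0.
rewrite exprMn (_ : G ^+ 4 * V ^+ 2 = G * V ^+ 2 * G ^+ 3); last by ring.
by rewrite ler_wpM2r ?exprn_ge0.
Qed.

End SignedInequalities.

Section SquareRootWeights.
Variables (R : rcfType) (T : zmodType) (e : bool) (A : {fset T}).
Hypothesis A_neq0 : A != fset0.
Local Notation n := ((#|` A|)%:R : R).
Local Notation D := (diffset A A).
Local Notation X := (signed_sumset e A).
Local Notation E := ((energy A)%:R : R).
Local Notation d p := ((deg A A p)%:R : R).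

Lemma sqrt_deg_gt0 p : p \in A -> 0 < Num.sqrt (d p).
Proof. by move=> pA; rewrite sqrtr_gt0 ltr0n deg_gt0. Qed.

Lemma rep_signed_sumset_ge_cor_invsqrt s :
  n ^+ 2 * cor A (fun p => (Num.sqrt (d p))^-1) (fun p => (Num.sqrt (d p))^-1) s
    <= (rep X s)%:R.
Proof.
rewrite -[leRHS]mul1r; apply: rep_signed_sumset_ge_cor => // p pA.
by rewrite exprVn sqr_sqrtr // mulVf // pnatr_eq0 -lt0n deg_gt0.
Qed.

Lemma energy3_ge_sum_sqrt_deg :
  n ^+ 2 * \sum_(p <- A) Num.sqrt (d p) <= (energy3 X A)%:R.
Proof.
set Z := \sum_(p <- A) _; pose f p := (Num.sqrt (d p))^-1.
have Z_ge0 : 0 <= Z by apply: sumr_ge0 => p _; apply: sqrtr_ge0.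
have energy3E : (energy3 X A)%:R = \sum_(s <- D) (rep X s)%:R * (rep A s)%:R ^+ 2 :> R.
  by rewrite natr_sum; apply: eq_bigr => s _; rewrite natrM natrX.
have sum_cor_rep : \sum_(s <- D) cor A f (fun=> 1) s * (rep A s)%:R = Z.
  rewrite sum_cor //; apply: eq_big_seq => p pA.
  under eq_bigr do rewrite mulr1.
  rewrite -mulr_sumr -natr_deg -[X in _ * X](sqr_sqrtr (ler0n R _)) expr2 mulrA.
  by rewrite mulVf ?mul1r // gt_eqF ?sqrt_deg_gt0.
have := @cauchy_schwarz_signed _ _ e A X (fun=> 1) f (fun=> 1) (fun s => (rep A s)%:R)
  (fsubset_refl _).
rewrite sum_cor_rep -natr_card_fset -energy3E; set F := (energy3 X A)%:R.
set Q := (X in _ <= _ * X) => nZ_le.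
have Q_le : n ^+ 2 * Q <= F.
  rewrite mulr_sumr /F energy3E; apply: ler_sum => s _.
  rewrite -!rep_cor.
  rewrite (_ : _ * _ = n ^+ 2 * cor A f f s * (rep A s)%:R ^+ 2); last by ring.
  by rewrite ler_wpM2r ?sqr_ge0 ?rep_signed_sumset_ge_cor_invsqrt.
rewrite -ler_sqr ?nnegrE ?mulr_ge0 ?sqr_ge0 ?ler0n //.
rewrite (_ : (n ^+ 2 * Z) ^+ 2 = n ^+ 2 * (n * Z) ^+ 2); last by ring.
apply: le_trans (ler_wpM2l (sqr_ge0 n) nZ_le) _.
by rewrite mulrCA [leRHS]expr2 ler_wpM2l.
Qed.

Lemma energyP_ge_sum_invsqrt_deg :
  n ^+ 18 * (\sum_(p <- A) (Num.sqrt (d p))^-1) ^+ 18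
    <= (energyP 3 D X)%:R ^+ 4 * (#|` D|)%:R ^+ 2.
Proof.
set Y := \sum_(p <- A) _.
have invsqrt_ge0 p : 0 <= (Num.sqrt (d p))^-1 by rewrite invr_ge0 sqrtr_ge0.
have := energyP_ge_weighted_cor (v := fun=> 1) (fsubset_refl _) (sqr_ge0 n)
  (fun p _ => invsqrt_ge0 p) (fun=> ler01) rep_signed_sumset_ge_cor_invsqrt.
rewrite sum_cor // (_ : \sum_(p <- A) \sum_(q <- A) _ = Y * Y); last first.
  by rewrite big_distrlr; apply: eq_bigr => p _; apply: eq_bigr => q _; rewrite mulr1.
under [X in _ <= _ * X ^+ 2 -> _]eq_bigr do rewrite expr1n.
by rewrite -natr_card_fset -/Y; congr (_ <= _); ring.
Qed.

Let n_gt0 : 0 < n.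
Proof. by rewrite ltr0n cardfs_gt0. Qed.

Let E_gt0 : 0 < E.
Proof. by rewrite ltr0n energy_gt0. Qed.

Let D_gt0 : 0 < (#|` D|)%:R :> R.
Proof. by rewrite ltr0n cardfs_gt0; apply/fset0Pn; exists 0; apply: diffset0. Qed.

Lemma energy3_lower_bound :
  n ^+ 13 / ((#|` D|)%:R ^+ 2 * E) <= (energy3 X A)%:R ^+ 2.
Proof.
pose Z : R := \sum_(p <- A) Num.sqrt (d p); pose H : R := \sum_(p <- A) (d p)^-1.
have Z_ge0 : 0 <= Z by apply: sumr_ge0 => p _; apply: sqrtr_ge0.
have H_ge0 : 0 <= H by apply: sumr_ge0 => p _; rewrite invr_ge0.
have n3_le : n ^+ 3 <= Z ^+ 2 * H.
  have -> : H = \sum_(p <- A) (Num.sqrt (d p))^-1 ^+ 2.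
    by apply: eq_bigr => p _; rewrite exprVn sqr_sqrtr.
  by apply: size_cube_le_sqr_sum_mul_sum_inv_sqr => p; apply: sqrt_deg_gt0.
have n2_le : n ^+ 2 <= E * H.
  rewrite -sum_deg_energy; apply: size_sqr_le_sum_mul_suminv => p pA.
  by rewrite ltr0n deg_gt0.
have nZ_le : (n ^+ 2 * Z) ^+ 2 <= (energy3 X A)%:R ^+ 2.
  by rewrite ler_sqr ?nnegrE ?mulr_ge0 ?sqr_ge0 ?energy3_ge_sum_sqrt_deg.
have nH_le : (n ^+ 2 * H) ^+ 2 <= (#|` D|)%:R ^+ 2.
  by rewrite ler_sqr ?nnegrE ?mulr_ge0 ?sqr_ge0 ?card_diffset_ge_sum_invdeg.
rewrite ler_pdivrMr ?mulr_gt0 ?exprn_gt0 //.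
apply: (@le_trans _ _ ((n ^+ 2 * Z) ^+ 2 * ((n ^+ 2 * H) ^+ 2 * E))).
  rewrite (_ : n ^+ 13 = n ^+ 8 * (n ^+ 3 * n ^+ 2)); last by ring.
  rewrite [leRHS](_ : _ = n ^+ 8 * ((Z ^+ 2 * H) * (E * H))); last by ring.
  by rewrite ler_wpM2l ?exprn_ge0 // ler_pM ?exprn_ge0.
by rewrite ler_pM ?mulr_ge0 ?sqr_ge0 // ler_wpM2r.
Qed.

Lemma energyP_lower_bound :
  Num.max ((#|` X|)%:R ^+ 12) (n ^+ 45 / (E ^+ 9 * (#|` D|)%:R ^+ 2))
    <= (energyP 3 D X)%:R ^+ 4.
Proof.
rewrite ge_max; apply/andP; split.
  rewrite (_ : _ ^+ 12 = ((#|` X|)%:R ^+ 3) ^+ 4); last by rewrite -exprM.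
  rewrite lerXn2r ?nnegrE ?exprn_ge0 // natr_energyP (big_fsetD1 0) ?diffset0 //=.
  by rewrite rep_slice slice0 lerDl sumr_ge0 // => s _; rewrite exprn_ge0.
pose Y : R := \sum_(p <- A) (Num.sqrt (d p))^-1.
have Y_ge0 : 0 <= Y by apply: sumr_ge0 => p _; rewrite invr_ge0 sqrtr_ge0.
have n3_le : n ^+ 3 <= Y ^+ 2 * E.
  have -> : E = \sum_(p <- A) (Num.sqrt (d p))^-1^-1 ^+ 2.
    by rewrite -sum_deg_energy; apply: eq_bigr => p _; rewrite invrK sqr_sqrtr.
  apply: size_cube_le_sqr_sum_mul_sum_inv_sqr => p pA.
  by rewrite invr_gt0 sqrt_deg_gt0.
rewrite ler_pdivrMr ?mulr_gt0 ?exprn_gt0 //.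
apply: (@le_trans _ _ (E ^+ 9 * (n ^+ 18 * Y ^+ 18))).
  rewrite [leRHS](_ : _ = n ^+ 18 * (Y ^+ 2 * E) ^+ 9); last by ring.
  rewrite (_ : n ^+ 45 = n ^+ 18 * (n ^+ 3) ^+ 9); last by rewrite -exprM -exprD.
  by rewrite ler_wpM2l ?exprn_ge0 // lerXn2r ?nnegrE ?mulr_ge0 ?exprn_ge0.
by rewrite [leRHS]mulrCA ler_wpM2l ?exprn_ge0 // energyP_ge_sum_invsqrt_deg.
Qed.

End SquareRootWeights.

Section RealEnergy.
Variables (R : realType) (T : zmodType).
Implicit Types (A B : {fset T}) (alpha : R).

Lemma energyR_ge0 alpha A : 0 <= energyR alpha A.
Proof. by apply: sumr_ge0 => s _; apply: powR_ge0. Qed.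

Lemma energyR_gt0 alpha A : A != fset0 -> 0 < energyR alpha A.
Proof.
move=> A_neq0; rewrite /energyR (big_fsetD1 0) ?diffset0 //=.
rewrite ltr_pwDl ?powR_gt0 ?ltr0n ?rep_gt0 ?diffset0 //.
by apply: sumr_ge0 => s _; apply: powR_ge0.
Qed.

Lemma energyR_natr k A : energyR k%:R A = (energyP k (diffset A A) A)%:R :> R.
Proof. by rewrite natr_energyP; apply: eq_bigr => s _; rewrite powR_mulrn. Qed.

Lemma energyR2 A : energyR 2 A = (energy A)%:R :> R.
Proof. exact: (energyR_natr 2). Qed.

Section PopularDifferences.
Variables (e : bool) (B X : {fset T}) (K : R).
Hypotheses (BX : (signed_sumset e B `<=` X)%fset) (K_ge0 : 0 <= K).
Hypothesis rep_le : forall s, K * (rep B s)%:R <= (rep X s)%:R.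
Local Notation G := ((energyP 3 (diffset B B) X)%:R : R).

Lemma energyP_ge_energyR alpha :
  K ^+ 9 * ((#|` B|)%:R * energyR alpha B) ^+ 6
    <= G ^+ 4 * energyR ((alpha - 1) * 3) B ^+ 2.
Proof.
have cor_le s : K * cor B (fun=> 1) (fun=> 1) s <= (rep X s)%:R by rewrite -rep_cor.
have := energyP_ge_weighted_cor (v := fun s => (rep B s)%:R `^ (alpha - 1)) BX K_ge0
  (fun p _ => ler01) (fun s => powR_ge0 _ _) cor_le.
rewrite -natr_card_fset; under [X in _ <= _ * X ^+ 2 -> _]eq_bigr do
  rewrite -powR_mulrn ?powR_ge0 // -powRrM.
rewrite [X in _ * (_ * X) ^+ 6 <= _ -> _](_ : _ = energyR alpha B) //.
apply: eq_big_seq => s; rewrite -rep_gt0 -rep_cor => repB_gt0.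
rewrite -[X in X * _]powRr1 // -powRD ?subrKC //.
by rewrite pnatr_eq0 -lt0n repB_gt0 implybT.
Qed.

Lemma energyP_ge_energy : K ^+ 5 * ((#|` B|)%:R * (energy B)%:R) ^+ 2 <= G ^+ 2.
Proof.
have G_ge0 : 0 <= G by apply: ler0n.
have E3_le : K ^+ 3 * energyR 3 B <= G.
  rewrite energyR_natr !natr_energyP mulr_sumr; apply: ler_sum => s _.
  by rewrite -exprMn lerXn2r ?nnegrE ?mulr_ge0.
have := energyP_ge_energyR 2; rewrite (_ : (2 - 1) * 3 = 3); last by ring.
rewrite energyR2; set L := (#|` B|)%:R * _ => L_le.
rewrite -(ler_pXn2r (ltn0Sn 2)) ?nnegrE ?mulr_ge0 ?exprn_ge0 //.
rewrite (_ : (K ^+ 5 * L ^+ 2) ^+ 3 = K ^+ 6 * (K ^+ 9 * L ^+ 6)); last by ring.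
apply: le_trans (ler_wpM2l (exprn_ge0 6 K_ge0) L_le) _.
rewrite [leLHS](_ : _ = G ^+ 4 * (K ^+ 3 * energyR 3 B) ^+ 2); last by ring.
rewrite (_ : (G ^+ 2) ^+ 3 = G ^+ 4 * G ^+ 2); last by ring.
by rewrite ler_wpM2l ?exprn_ge0 // lerXn2r ?nnegrE ?mulr_ge0 ?exprn_ge0 ?energyR_ge0.
Qed.

Lemma energyP_ge_energyR32 : B != fset0 ->
  K ^+ 9 * (#|` B|)%:R ^+ 6 * energyR (3 / 2) B ^+ 4 <= G ^+ 4.
Proof.
move=> B_neq0; have := energyP_ge_energyR (3 / 2).
rewrite (_ : (3 / 2 - 1) * 3 = 3 / 2); last by lra.
set W := energyR _ B; have W_gt0 : 0 < W ^+ 2 by rewrite exprn_gt0 ?energyR_gt0.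
by move=> W_le; rewrite -(ler_pM2r W_gt0); move: W_le; congr (_ <= _); ring.
Qed.

End PopularDifferences.

Lemma connected_half alpha beta gamma A B :
  0 <= alpha -> beta <= 1 / 2 -> 0 <= gamma -> connected alpha beta gamma A ->
  A != fset0 -> (B `<=` A)%fset -> (#|` A|)%:R <= 2 * (#|` B|)%:R :> R ->
  gamma * energyR alpha A <= 2 `^ (2 * alpha) * energyR alpha B.
Proof.
move=> alpha_ge0 beta_le gamma_ge0 conn A_neq0 BA half.
have n_gt0 : 0 < (#|` A|)%:R :> R by rewrite ltr0n cardfs_gt0.
have B_large : beta * (#|` A|)%:R <= (#|` B|)%:R.
  by apply: le_trans (ler_wpM2r (ltW n_gt0) beta_le) _; lra.
apply: le_trans (ler_wpM2l (powR_ge0 _ _) (conn B BA B_large)).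
rewrite [leRHS](_ : _ = 2 `^ (2 * alpha) * ((#|` B|)%:R / (#|` A|)%:R) `^ (2 * alpha)
  * (gamma * energyR alpha A)); last by ring.
rewrite ler_peMl ?mulr_ge0 ?energyR_ge0 // -powRM ?divr_ge0 //.
rewrite [leLHS](_ : 1 = 1 `^ (2 * alpha)); last by rewrite powR1.
apply: ge0_ler_powR; rewrite ?nnegrE ?mulr_ge0 ?invr_ge0 //.
by rewrite mulrA ler_pdivlMr // mul1r.
Qed.

End RealEnergy.

(* At [k = 1] the logarithm vanishes and the quotient is [0] by convention. *)
Lemma div_mul_log2_natr_le (R : realType) (a b c : R) (k m : nat) :
  0 <= a -> 0 < b -> 0 <= c -> (0 < k)%N -> a ^+ m.+1 <= (c * b) ^+ m.+1 ->
  a / (b * log2 k%:R) <= c.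
Proof.
move=> a_ge0 b_gt0 c_ge0; case: k => [//|[|k]] _.
  by rewrite /log2 ln1 mul0r mulr0 invr0 mulr0.
rewrite ler_pXn2r ?nnegrE ?mulr_ge0 ?(ltW b_gt0) // => a_le.
have ln2_gt0 : 0 < ln (2 : R) by rewrite ln_gt0 ?ltr1n.
have log2_ge1 : 1 <= log2 (k.+2%:R : R).
  by rewrite /log2 ler_pdivlMr // mul1r ler_ln ?posrE ?ltr0n // ler_nat.
have log2_gt0 : 0 < log2 (k.+2%:R : R) := lt_le_trans ltr01 log2_ge1.
rewrite ler_pdivrMr; last exact: mulr_gt0.
by apply: le_trans a_le _; rewrite [leRHS]mulrA ler_peMr ?mulr_ge0 // ltW.
Qed.

Lemma powR_natr_div_expr (R : realType) (x : R) (k m : nat) :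
  0 <= x -> (0 < m)%N -> (x `^ (k%:R / m%:R)) ^+ m = x ^+ k.
Proof.
move=> x_ge0 m_gt0; rewrite -powR_mulrn ?powR_ge0 // -powRrM divfK ?powR_mulrn //.
by rewrite pnatr_eq0 -lt0n.
Qed.

Section ConnectedSets.
Variables (R : realType) (T : zmodType) (e : bool) (A : {fset T}) (beta gamma : R).
Hypotheses (A_neq0 : A != fset0) (beta_le : beta <= 1 / 2) (gamma_ge0 : 0 <= gamma).
Local Notation n := ((#|` A|)%:R : R).
Local Notation D := (diffset A A).
Local Notation X := (signed_sumset e A).
Local Notation E := ((energy A)%:R : R).
Local Notation d p := ((deg A A p)%:R : R).
Local Notation G := ((energyP 3 D X)%:R : R).

Let n_gt0 : 0 < n.
Proof. by rewrite ltr0n cardfs_gt0. Qed.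

Let E_gt0 : 0 < E.
Proof. by rewrite ltr0n energy_gt0. Qed.

Lemma energy3_lower_bound_connected : connected 2 beta gamma A ->
  gamma * n ^+ 5 * E <= 32 * (energy3 X A)%:R ^+ 2.
Proof.
move=> conn; pose w p := Num.sqrt (d p).
pose B := regular_part A w; pose Z := \sum_(p <- A) w p.
have w_ge0 p : 0 <= w p by apply: sqrtr_ge0.
have Z_gt0 : 0 < Z.
  have /fset0Pn[a aA] := A_neq0.
  by rewrite /Z (big_fsetD1 a) //= ltr_pwDl ?sqrt_deg_gt0 ?sumr_ge0.
have half : n <= 2 * (#|` B|)%:R by apply: card_regular_part.
have BA : (B `<=` A)%fset := regular_part_sub A w.
have energyB_le : (energy B)%:R <= 2 * Z / n * Z.
  apply: le_trans (energy_le_sum_deg R BA) _; rewrite mulr_sumr.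
  apply: le_trans (ler_sum_fsubset BA _); last first.
    by move=> p _; rewrite !mulr_ge0 ?invr_ge0 ?(ltW Z_gt0).
  rewrite big_seq [leRHS]big_seq; apply: ler_sum => p /regular_part_le w_le.
  by rewrite -[leLHS](sqr_sqrtr (ler0n R _)) expr2 ler_wpM2r ?w_ge0.
have := connected_half (ler0n R 2) beta_le gamma_ge0 conn A_neq0 BA half.
rewrite !energyR2 -natrM powR_mulrn // => conn_le.
have gammaE_le : gamma * E * n <= 32 * Z ^+ 2.
  rewrite -ler_pdivlMr //; apply: le_trans conn_le _.
  apply: le_trans (ler_wpM2l (exprn_ge0 4 (ler0n R 2)) energyB_le) _.
  by rewrite le_eqVlt; apply/predU1l; ring.
have Z_le : n ^+ 4 * Z ^+ 2 <= (energy3 X A)%:R ^+ 2.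
  rewrite (_ : _ * _ = (n ^+ 2 * Z) ^+ 2); last by ring.
  rewrite ler_sqr ?nnegrE ?mulr_ge0 ?sqr_ge0 ?(ltW Z_gt0) //.
  exact: energy3_ge_sum_sqrt_deg.
by have := ler_wpM2l (exprn_ge0 4 (ltW n_gt0)) gammaE_le; lra.
Qed.

(* [n^3 / 2E] is [n^2] divided by twice the mean of [deg]. *)
Local Notation K := (n ^+ 3 / (2 * E)).

Let K_ge0 : 0 <= K.
Proof. by rewrite divr_ge0 ?exprn_ge0 ?mulr_ge0. Qed.

Lemma connected_popular_half (alpha : R) : 0 <= alpha -> connected alpha beta gamma A ->
  exists B : {fset T}, [/\ (B `<=` A)%fset, n <= 2 * (#|` B|)%:R,
    gamma * energyR alpha A <= 2 `^ (2 * alpha) * energyR alpha B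
    & forall s, K * (rep B s)%:R <= (rep X s)%:R].
Proof.
move=> alpha_ge0 conn; pose B := regular_part A (fun p => d p).
have BA : (B `<=` A)%fset by apply: regular_part_sub.
have half : n <= 2 * (#|` B|)%:R.
  by apply: card_regular_part => //; rewrite sum_deg_energy.
exists B; split=> // [|s].
  exact: (connected_half alpha_ge0 beta_le gamma_ge0 conn).
have M_gt0 : 0 < 2 * E / n by rewrite divr_gt0 ?mulr_gt0.
have MK : 2 * E / n * K = n ^+ 2 by field; rewrite !gt_eqF.
rewrite -(ler_pM2l M_gt0) mulrA MK rep_cor.
apply: rep_signed_sumset_ge_cor A_neq0 BA (ltW M_gt0) _.
by move=> p /regular_part_le; rewrite sum_deg_energy expr1n mul1r.
Qed.

Lemma energyP_lower_bound_connected2 : connected 2 beta gamma A ->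
  gamma ^+ 2 * n ^+ 17 <= 2 ^+ 15 * E ^+ 3 * G ^+ 2.
Proof.
move=> /(connected_popular_half (ler0n R 2))[B [BA half conn_le rep_le]].
rewrite !energyR2 -natrM powR_mulrn // in conn_le.
set b := (#|` B|)%:R in half; set W := (energy B)%:R in conn_le.
have nE_le : (n * (gamma * E)) ^+ 2 <= 2 ^+ 10 * (b * W) ^+ 2.
  rewrite [leRHS](_ : _ = (2 * b * (2 ^+ 4 * W)) ^+ 2); last by ring.
  by rewrite ler_sqr ?nnegrE ?mulr_ge0 ?exprn_ge0 // ler_pM ?mulr_ge0.
have bW_le : K ^+ 5 * (b * W) ^+ 2 <= G ^+ 2.
  apply: le_trans (energyP_ge_energy (signed_sumsetS e BA) K_ge0 rep_le) _.
  by rewrite ler_sqr ?nnegrE // natr_energyPS // diffsetS.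
have : K ^+ 5 * (n * (gamma * E)) ^+ 2 <= 2 ^+ 10 * G ^+ 2.
  apply: le_trans (ler_wpM2l (exprn_ge0 5 K_ge0) nE_le) _.
  by rewrite mulrCA ler_wpM2l ?exprn_ge0.
rewrite (_ : K ^+ 5 * _ = gamma ^+ 2 * n ^+ 17 / (2 ^+ 5 * E ^+ 3)); last first.
  by field; rewrite gt_eqF.
by rewrite ler_pdivrMr ?mulr_gt0 ?exprn_gt0 //; lra.
Qed.

Lemma energyP_lower_bound_connected32 : connected (3 / 2) beta gamma A ->
  gamma ^+ 4 * n ^+ 33 * energyR (3 / 2) A ^+ 4 <= 2 ^+ 27 * E ^+ 9 * G ^+ 4.
Proof.
have alpha_ge0 : 0 <= 3 / 2 :> R by rewrite divr_ge0.
move=> /(connected_popular_half alpha_ge0)[B [BA half conn_le rep_le]].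
have B_neq0 : B != fset0.
  by rewrite -cardfs_gt0 -(ltr0n R) -(pmulr_rgt0 _ (ltr0n R 2)) (lt_le_trans n_gt0).
rewrite (_ : 2 * (3 / 2) = 3%:R) ?powR_mulrn // in conn_le; last by lra.
set b := (#|` B|)%:R in half; move: conn_le.
set V := energyR _ A; set W := energyR _ B => conn_le.
have V_ge0 : 0 <= V := energyR_ge0 _ _; have W_ge0 : 0 <= W := energyR_ge0 _ _.
have nV_le : n ^+ 6 * (gamma * V) ^+ 4 <= 2 ^+ 18 * (b ^+ 6 * W ^+ 4).
  rewrite [leRHS](_ : _ = (2 * b) ^+ 6 * (2 ^+ 3 * W) ^+ 4); last by ring.
  by rewrite ler_pM ?exprn_ge0 ?mulr_ge0 // lerXn2r ?nnegrE ?mulr_ge0 ?exprn_ge0.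
have bW_le : K ^+ 9 * (b ^+ 6 * W ^+ 4) <= G ^+ 4.
  rewrite mulrA.
  apply: le_trans (energyP_ge_energyR32 (signed_sumsetS e BA) K_ge0 rep_le B_neq0) _.
  by rewrite lerXn2r ?nnegrE // natr_energyPS // diffsetS.
have : K ^+ 9 * (n ^+ 6 * (gamma * V) ^+ 4) <= 2 ^+ 18 * G ^+ 4.
  apply: le_trans (ler_wpM2l (exprn_ge0 9 K_ge0) nV_le) _.
  by rewrite mulrCA ler_wpM2l ?exprn_ge0.
rewrite (_ : K ^+ 9 * _ = gamma ^+ 4 * n ^+ 33 * V ^+ 4 / (2 ^+ 9 * E ^+ 9)).
  by rewrite ler_pdivrMr ?mulr_gt0 ?exprn_gt0 //; lra.
by field; rewrite gt_eqF.
Qed.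

Lemma energyP_ge_connected2 : connected 2 beta gamma A ->
  2^-1 ^+ 8 * gamma * n `^ (17 / 2) / (E `^ (3 / 2) * log2 n) <= G.
Proof.
move=> /energyP_lower_bound_connected2 G_le.
apply: (@div_mul_log2_natr_le _ _ _ _ _ 1); rewrite ?cardfs_gt0 ?powR_gt0 //.
  by rewrite !mulr_ge0 ?invr_ge0 ?powR_ge0.
rewrite !exprMn !powR_natr_div_expr //.
have : 0 <= E ^+ 3 * G ^+ 2 by rewrite mulr_ge0 ?exprn_ge0.
by move: G_le; lra.
Qed.

Lemma energyP_ge_connected32 : connected (3 / 2) beta gamma A ->
  2^-1 ^+ 8 * gamma * (n `^ (33 / 4) * energyR (3 / 2) A) / (E `^ (9 / 4) * log2 n)
    <= G.
Proof.
move=> /energyP_lower_bound_connected32 G_le.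
apply: (@div_mul_log2_natr_le _ _ _ _ _ 3); rewrite ?cardfs_gt0 ?powR_gt0 //.
  by rewrite !mulr_ge0 ?invr_ge0 ?powR_ge0 ?energyR_ge0.
rewrite !exprMn !powR_natr_div_expr //.
have : 0 <= E ^+ 9 * G ^+ 4 by rewrite mulr_ge0 ?exprn_ge0.
by move: G_le; lra.
Qed.

End ConnectedSets.

Theorem theorem11 (R : realType) :
  exists c : R, 0 < c /\
  forall (T : zmodType) (A : {fset T}), A != fset0 ->
  let D := diffset A A in
  let S := sumset A A in
  let nA : R := (#|` A|)%:R in
  let nD : R := (#|` D|)%:R in
  let nS : R := (#|` S|)%:R in
  let EA : R := (energy A)%:R in
  (* first part *)
  ((energy3 D A)%:R ^+ 2 >= nA ^+ 13 / (nD ^+ 2 * EA) /\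
   (energy3 S A)%:R ^+ 2 >= nA ^+ 13 / (nD ^+ 2 * EA)) /\
  ((energyP 3 D D)%:R ^+ 4 >= Num.max (nD ^+ 12) (nA ^+ 45 / (EA ^+ 9 * nD ^+ 2)) /\
   (energyP 3 D S)%:R ^+ 4 >= Num.max (nS ^+ 12) (nA ^+ 45 / (EA ^+ 9 * nD ^+ 2))) /\
  (* connected part *)
  forall beta gamma : R, 0 <= beta -> beta <= 1/2 -> 0 <= gamma -> gamma <= 1 ->
  (connected 2 beta gamma A ->
     (energy3 D A)%:R ^+ 2 >= c * gamma * nA ^+ 5 * EA /\
     (energy3 S A)%:R ^+ 2 >= c * gamma * nA ^+ 5 * EA) /\
  (connected (3/2) beta gamma A ->
     (energyP 3 D D)%:R >= c * gamma * (nA `^ (33/4) * energyR (3/2) A)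
                                      / (EA `^ (9/4) * log2 nA) /\
     (energyP 3 D S)%:R >= c * gamma * (nA `^ (33/4) * energyR (3/2) A)
                                      / (EA `^ (9/4) * log2 nA)) /\
  (connected 2 beta gamma A ->
     (energyP 3 D D)%:R >= c * gamma * nA `^ (17/2) / (EA `^ (3/2) * log2 nA) /\
     (energyP 3 D S)%:R >= c * gamma * nA `^ (17/2) / (EA `^ (3/2) * log2 nA)).
Proof.
exists (2^-1 ^+ 8); split; first by rewrite exprn_gt0 ?invr_gt0.
move=> T A A_neq0 D S nA nD nS EA.
have signedE := (signed_sumset_true A, signed_sumset_false A).
split.
  have bound e := energy3_lower_bound R e A_neq0.
  by move: (bound true) (bound false); rewrite !signedE.
split.
  have bound e := energyP_lower_bound R e A_neq0.
  by move: (bound true) (bound false); rewrite !signedE.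
move=> beta gamma _ beta_le gamma_ge0 _; split=> [conn|].
  have bound e :
      2^-1 ^+ 8 * gamma * nA ^+ 5 * EA <= (energy3 (signed_sumset e A) A)%:R ^+ 2.
    have := energy3_lower_bound_connected e A_neq0 beta_le gamma_ge0 conn.
    by have := sqr_ge0 ((energy3 (signed_sumset e A) A)%:R : R); rewrite /nA /EA; lra.
  by move: (bound true) (bound false); rewrite !signedE.
split=> conn.
  have bound e := energyP_ge_connected32 e A_neq0 beta_le gamma_ge0 conn.
  by move: (bound true) (bound false); rewrite !signedE.
have bound e := energyP_ge_connected2 e A_neq0 beta_le gamma_ge0 conn.
by move: (bound true) (bound false); rewrite !signedE.
Qed.
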